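(* Let $\tilde A_i=(a_i;\,l_i^{\mu L},r_i^{\mu L},l_i^{\mu U},r_i^{\mu U};\,l_i^{\nu L},r_i^{\nu L},l_i^{\nu U},r_i^{\nu U})_{LR}$, $i=1,2$, be $LR$-type IVIFNs with the same shape functions, where $a_1-l_1^{\mu L}<0$ and $a_1\ge0$, and $\tilde A_2$ is arbitrary. Then $\tilde A_1\odot\tilde A_2=(a;\,l^{\mu L},r^{\mu L},l^{\mu U},r^{\mu U};\,l^{\nu L},r^{\nu L},l^{\nu U},r^{\nu U})_{LR}$, where $a=a_1a_2$ and, for each $\kappa\in\{\mu L,\mu U,\nu L,\nu U\}$, $$l^\kappa=a_1a_2-\min\{(a_1-l_1^\kappa)(a_2+r_2^\kappa),(a_1+r_1^\kappa)(a_2-l_2^\kappa)\},\quad r^\kappa=\max\{(a_1+r_1^\kappa)(a_2+r_2^\kappa),(a_1-l_1^\kappa)(a_2-l_2^\kappa)\}-a_1a_2.$$ Moreover the conditions for an $LR$-type representation hold: all eight spreads of the product are positive and $l^{\mu U}\ge l^{\mu L}$, $l^{\nu L}\ge l^{\nu U}$, $l^{\nu L}\ge l^{\mu L}$, $l^{\nu U}\ge l^{\mu U}$, and likewise with $r$ in place of $l$.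
   Context: A shape function is a continuous, strictly decreasing, invertible $f:[0,\infty)\to[0,1]$ with $f(0)=1$ and $\lim_{x\to\infty}f(x)=0$. Fix shape functions $L,R,L',R'$. An $LR$-type interval-valued intuitionistic fuzzy number (IVIFN) is written $\tilde A=(a;l^{\mu L},r^{\mu L},l^{\mu U},r^{\mu U};l^{\nu L},r^{\nu L},l^{\nu U},r^{\nu U})_{LR}$, where $a\in\mathbb R$ is its mean value and the eight spreads are positive reals with $l^{\mu U}\ge l^{\mu L}$, $r^{\mu U}\ge r^{\mu L}$, $l^{\nu L}\ge l^{\nu U}$, $r^{\nu L}\ge r^{\nu U}$, $l^{\nu L}\ge l^{\mu L}$, $r^{\nu L}\ge r^{\mu L}$, $l^{\nu U}\ge l^{\mu U}$, $r^{\nu U}\ge r^{\mu U}$. It encodes a lower membership function equal to $L((a-x)/l^{\mu L})$ on $[a-l^{\mu L},a]$, $R((x-a)/r^{\mu L})$ on $[a,a+r^{\mu L}]$, and $0$ otherwise; an upper membership function of the same form with $L',R',l^{\mu U},r^{\mu U}$; a lower non-membership function equal to $1-L((a-x)/l^{\nu L})$ on $[a-l^{\nu L},a]$, $1-R((x-a)/r^{\nu L})$ on $[a,a+r^{\nu L}]$, and $1$ otherwise; and an upper non-membership function of the same form with $L',R',l^{\nu U},r^{\nu U}$. At each $x$ the supremum of the membership interval plus the supremum of the non-membership interval is at most $1$. The product $\tilde A_1\odot\tilde A_2$ is formed cutwise by interval multiplication and read off at the level where the inverse shape functions equal $0$ (giving the mean) and at the level where they equal $1$ (giving the spreads). That is,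 it is the tuple (with the same shape functions) with mean $a=a_1a_2$ and spreads determined, for each $\kappa\in\{\mu L,\mu U,\nu L,\nu U\}$, by $$[a-l^{\kappa},a+r^{\kappa}]=[a_1-l_1^{\kappa},a_1+r_1^{\kappa}]\times[a_2-l_2^{\kappa},a_2+r_2^{\kappa}],$$ where $I\times J=\{xy:x\in I,y\in J\}$. *)

(* Defs.v *)
From HB Require Import structures.
From mathcomp Require Import all_boot all_order all_algebra.
From mathcomp Require Import all_classical all_reals all_analysis.

Set Implicit Arguments.
Unset Strict Implicit.
Unset Printing Implicit Defensive.

Import Order.TTheory GRing.Theory Num.Theory.
Import numFieldNormedType.Exports.

Local Open Scope classical_set_scope.
Local Open Scope ring_scope.

(* Only the restriction of f to [0, +oo[ matters.  A strictly decreasing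
   function with values in [0, 1] never takes the value 0, so "invertible" can
   only mean bijective onto ]0, 1]. *)
Definition shape_function (K : realType) (f : K -> K) : Prop :=
  [/\ {within `[0, +oo[, continuous f},
      forall x y : K, 0 <= x -> x < y -> f y < f x,
      set_fun `[0, +oo[ `[0, 1] f /\ set_bij `[0, +oo[ `]0, 1] f,
      f 0 = 1
    & f x @[x --> +oo] --> (0 : K)].

Inductive grade := muL | muU | nuL | nuU.

Record lr_tuple (K : realType) := LRTuple {
  mean : K;
  lspread : grade -> K;
  rspread : grade -> K }.

Definition cut_interval (K : realType) (A : lr_tuple K) (k : grade) : set K :=
  `[mean A - lspread A k, mean A + rspread A k].

Definition membership (K : realType) (f g : K -> K) (k : grade)
    (A : lr_tuple K) (x : K) : K :=
  let a := mean A in let l := lspread A k in let r := rspread A k in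
  if a - l <= x <= a then f ((a - x) / l)
  else if a <= x <= a + r then g ((x - a) / r)
  else 0.

Definition nonmembership (K : realType) (f g : K -> K) (k : grade)
    (A : lr_tuple K) (x : K) : K :=
  let a := mean A in let l := lspread A k in let r := rspread A k in
  if a - l <= x <= a then 1 - f ((a - x) / l)
  else if a <= x <= a + r then 1 - g ((x - a) / r)
  else 1.

Definition spread_ordering (K : realType) (s : grade -> K) : Prop :=
  [/\ s muL <= s muU, s nuU <= s nuL, s muL <= s nuL & s muU <= s nuU].

Definition lr_conditions (K : realType) (A : lr_tuple K) : Prop :=
  [/\ forall k, 0 < lspread A k,
      forall k, 0 < rspread A k,
      spread_ordering (lspread A)
    & spread_ordering (rspread A)].

(* L and R shape the lower functions, L' and R' the upper ones.  The spread
   conditions alone do not force lower <= upper when the shapes differ; where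
   it fails the interval is set0 and its sup is 0. *)
Definition membership_interval (K : realType) (L R L' R' : K -> K)
    (A : lr_tuple K) (x : K) : set K :=
  `[membership L R muL A x, membership L' R' muU A x].

Definition nonmembership_interval (K : realType) (L R L' R' : K -> K)
    (A : lr_tuple K) (x : K) : set K :=
  `[nonmembership L R nuL A x, nonmembership L' R' nuU A x].

Definition ivifn (K : realType) (L R L' R' : K -> K) (A : lr_tuple K) : Prop :=
  lr_conditions A /\
  forall x, sup (membership_interval L R L' R' A x) +
            sup (nonmembership_interval L R L' R' A x) <= 1.

Definition interval_mul (K : realType) (I J : set K) : set K :=
  [set x * y | x in I & y in J].

(* A relation: the interval equations determine at most one tuple A. *)
Definition is_lr_product (K : realType) (A1 A2 A : lr_tuple K) : Prop :=
  mean A = mean A1 * mean A2 /\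
  forall k, cut_interval A k =
            interval_mul (cut_interval A1 k) (cut_interval A2 k).

(* Main.v *)
Require Import Defs.
From HB Require Import structures.
From mathcomp Require Import all_boot all_order all_algebra.
From mathcomp Require Import all_classical all_reals all_analysis.
From mathcomp Require Import lra.

Import Order.TTheory GRing.Theory Num.Theory.
Import numFieldNormedType.Exports.

Local Open Scope classical_set_scope.
Local Open Scope ring_scope.

(* Since every cut [p1, q1] of the first factor contains 0, the product of
   [p1, q1] and [p2, q2] is an interval around 0 whose endpoints are
   min (p1 q2) (q1 p2) and max (q1 q2) (p1 p2).  The ordering of the spreads of
   the product then follows from inclusion of cuts, and the bound on
   membership plus non-membership follows from the ordering of the spreads
   alone, because the two upper functions have the same shapes. *)

Section IntervalProduct.
Context {K : realType}.
Implicit Types p q x y z : K.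

(** The signs of [x] and [y] single out a corner that bounds [x * y] on the side of its own sign. On
    the other side a corner of the opposite sign, or zero, suffices, and [p1 <= 0 <= q1] supplies
    one. *)
Lemma mul_interval_bounds p1 q1 p2 q2 x y : p1 <= 0 <= q1 ->
  p1 <= x <= q1 -> p2 <= y <= q2 ->
  Num.min (p1 * q2) (q1 * p2) <= x * y <= Num.max (q1 * q2) (p1 * p2).
Proof.
move=> /andP[p10 q10] /andP[px xq] /andP[py yq].
rewrite ge_min le_max; have [x0|x0] := leP 0 x.
  have [y0|y0] := leP 0 y; apply/andP; split; apply/orP.
  - by left; nra.
  - by left; nra.
  - by right; nra.
  - have [q0|q0] := leP 0 q2; first by left; nra.
    by right; nra.
have [y0|y0] := leP 0 y; apply/andP; split; apply/orP.
- by left; nra.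
- have [q0|q0] := leP 0 q2; first by left; nra.
  by right; nra.
- have [q0|q0] := leP 0 q2; first by left; nra.
  by right; nra.
- by right; nra.
Qed.

(** As [[p1, q1]] contains 0, it is stable under scaling by [t] in [[0, 1]]; with [t = z / (c * d)],
    [z] is the product of [t * c] and [d]. *)
Lemma mul_interval_scaled p1 q1 p2 q2 c d z : p1 <= 0 <= q1 ->
  p1 <= c <= q1 -> p2 <= d <= q2 -> 0 <= z <= c * d \/ c * d <= z <= 0 ->
  interval_mul `[p1, q1] `[p2, q2] z.
Proof.
move=> h0 hc hd hz; have [cd0|cd0] := eqVneq (c * d) 0.
  exists 0; first by rewrite /= in_itv.
  by exists d; rewrite ?mul0r /= ?in_itv //; move: hz; rewrite cd0; lra.
pose t := z / (c * d); have zE : z = t * (c * d) by rewrite /t divfK.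
have t0 : 0 <= t by case: (ltgtP (c * d) 0) cd0 hz => // s _; nra.
have t1 : t <= 1 by case: (ltgtP (c * d) 0) cd0 hz => // s _; nra.
exists (t * c); last by exists d; rewrite /= ?in_itv // zE mulrA.
by rewrite /= in_itv /=; apply/andP; split; nra.
Qed.

Lemma interval_mulE p1 q1 p2 q2 : p1 <= 0 <= q1 -> p2 <= q2 ->
  interval_mul `[p1, q1] `[p2, q2] =
  `[Num.min (p1 * q2) (q1 * p2), Num.max (q1 * q2) (p1 * p2)]%classic.
Proof.
move=> h0 h2; apply/seteqP; split => [_ [x hx [y hy <-]]|z] /=.
  move: hx hy; rewrite /= !in_itv /=; exact: mul_interval_bounds.
rewrite in_itv /= ge_min le_max => /andP[/orP hm /orP hM].
(* A nonnegative [z] lies between 0 and the corner attaining the max, a negative one between the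
   corner attaining the min and 0. *)
have [z0|z0] := leP 0 z.
  by case: hM => hM; [apply: (mul_interval_scaled _ _ _ _ q1 q2)
                     |apply: (mul_interval_scaled _ _ _ _ p1 p2)]; lra.
by case: hm => hm; [apply: (mul_interval_scaled _ _ _ _ p1 q2)
                   |apply: (mul_interval_scaled _ _ _ _ q1 p2)]; lra.
Qed.

(** Nonemptiness of one interval passes to the other, so each contains the endpoints of the
    other. *)
Lemma itvcc_inj p q p' q' : p' <= q' ->
  `[p, q]%classic = `[p', q']%classic -> p = p' /\ q = q'.
Proof.
move=> le' eqI.
have inI x : (p <= x <= q) = (p' <= x <= q').
  by apply/idP/idP => hx; move: (eqI) => /seteqP[h1 h2];
    [have := h1 x | have := h2 x]; rewrite /= !in_itv /=; apply.
have := inI p'; rewrite lexx le' /= => h1.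
have := inI q'; rewrite lexx le' /= => h2.
have pq : p <= q by lra.
have := inI p; rewrite lexx pq /= => h3.
have := inI q; rewrite lexx pq /= => h4.
by split; lra.
Qed.

(** The condition [0 <= z] covers the empty interval, whose [sup] is 0 by convention. *)
Lemma ge_sup_itvcc p q z : q <= z -> 0 <= z -> sup `[p, q]%classic <= z.
Proof.
move=> qz z0; have [->|/set0P ne] := eqVneq `[p, q]%classic set0.
  by rewrite sup0.
by apply: ge_sup => // x; rewrite /= in_itv /= => /andP[_ /le_trans]; apply.
Qed.

End IntervalProduct.

Section Membership.
Context {K : realType}.
Implicit Types (f g : K -> K) (A : lr_tuple K).

Lemma shape_function_ge0_le1 {f} x : shape_function f -> 0 <= x ->
  0 <= f x <= 1.
Proof.
by move=> [_ _ [h _] _ _] x0; have := h x; rewrite /= !in_itv /= andbT; apply.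
Qed.

Lemma shape_function_le {f} x y : shape_function f -> 0 <= x -> x <= y ->
  f y <= f x.
Proof.
move=> [_ h _ _ _] x0; rewrite le_eqVlt => /predU1P[->//|xy].
exact/ltW/h.
Qed.

(** A larger spread gives a smaller argument, hence a larger shape value: on both cuts the sum is
    [1 + h (t / s) - h (t / s')] with [s <= s']. Off the smaller cut the membership is 0. *)
Lemma membership_complement f g k k' A x :
    shape_function f -> shape_function g -> lr_conditions A ->
    lspread A k <= lspread A k' -> rspread A k <= rspread A k' ->
  [/\ 0 <= membership f g k A x, membership f g k A x <= 1,
      0 <= nonmembership f g k' A x, nonmembership f g k' A x <= 1
    & membership f g k A x + nonmembership f g k' A x <= 1].
Proof.
move=> hf hg [lp rp _ _] hl hr; rewrite /membership /nonmembership.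
set a := mean A.
have := lp k; have := lp k'; have := rp k; have := rp k'.
move: hl hr; set l := lspread A k; set l' := lspread A k'.
set r := rspread A k; set r' := rspread A k' => hl hr r'0 r0 l'0 l0.
have bnd (h : K -> K) (s t : K) : shape_function h -> 0 < s -> 0 <= t -> 0 <= h (t / s) <= 1.
  by move=> hh s0 t0; apply: shape_function_ge0_le1 => //; rewrite divr_ge0// ltW.
have mon (h : K -> K) (s s' t : K) : shape_function h -> 0 < s -> s <= s' -> 0 <= t ->
    h (t / s) <= h (t / s').
  move=> hh s0 ss' t0; have s'0 : 0 < s' by apply: lt_le_trans ss'.
  apply: shape_function_le => //; first by rewrite divr_ge0// ltW.
  by apply: ler_wpM2l => //; rewrite lef_pV2.
case: (leP x a) => xa.
  have ax : 0 <= a - x by lra.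
  have := bnd f l _ hf l0 ax; have := bnd f l' _ hf l'0 ax.
  have := mon f l l' _ hf l0 hl ax.
  have outF (m : K) : 0 < m -> x < a - m -> (a <= x) = false.
    by move=> m0 xam; apply/lt_geF; lra.
  rewrite !andbT; case: (leP (a - l) x) => [h1|/(outF _ l0) ->];
    by case: (leP (a - l') x) => [h2|h2] /=; split; lra.
have ax : 0 <= x - a by lra.
have := bnd g r _ hg r0 ax; have := bnd g r' _ hg r'0 ax.
have := mon g r r' _ hg r0 hr ax.
rewrite !andbF (ltW xa) /=; case: (leP x (a + r)) => h1;
  case: (leP x (a + r')) => h2; by split; lra.
Qed.

Lemma lr_conditions_ivifn L R L' R' A :
    shape_function L -> shape_function R ->
    shape_function L' -> shape_function R' ->
  lr_conditions A -> ivifn L R L' R' A.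
Proof.
move=> hL hR hL' hR' hA; split=> // x.
have [_ _ [_ _ _ hl] [_ _ _ hr]] := hA.
have [m0 m1 n0 n1 mn] := membership_complement _ _ _ _ _ x hL' hR' hA hl hr.
rewrite /membership_interval /nonmembership_interval.
have := ge_sup_itvcc (membership L R muL A x) _ _ (lexx _) m0.
have := ge_sup_itvcc (nonmembership L R nuL A x) _ _ (lexx _) n0.
by lra.
Qed.

End Membership.

Theorem proposition3p1p6 (K : realType) (L R L' R' : K -> K)
    (hL : shape_function L) (hR : shape_function R)
    (hL' : shape_function L') (hR' : shape_function R')
    (A1 A2 : lr_tuple K)
    (hA1 : ivifn L R L' R' A1) (hA2 : ivifn L R L' R' A2)
    (hneg : mean A1 - lspread A1 muL < 0) (hpos : 0 <= mean A1) :
  let A := LRTuple (mean A1 * mean A2)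
    (fun k => mean A1 * mean A2 -
       Num.min ((mean A1 - lspread A1 k) * (mean A2 + rspread A2 k))
               ((mean A1 + rspread A1 k) * (mean A2 - lspread A2 k)))
    (fun k =>
       Num.max ((mean A1 + rspread A1 k) * (mean A2 + rspread A2 k))
               ((mean A1 - lspread A1 k) * (mean A2 - lspread A2 k)) -
       mean A1 * mean A2) in
  (forall B : lr_tuple K, is_lr_product A1 A2 B <-> B = A) /\
  ivifn L R L' R' A.
Proof.
move=> A; have [[l1 r1 ol1 or1] _] := hA1; have [[l2 r2 ol2 or2] _] := hA2.
(* [muL] has the smallest left spread of the four grades. *)
have neg k : mean A1 - lspread A1 k < 0.
  by case: ol1 => ? ? ? ?; case: k; lra.
have zero_in k : mean A1 - lspread A1 k <= 0 <= mean A1 + rspread A1 k.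
  by have := neg k; have := r1 k; lra.
have cutA k : cut_interval A k =
    interval_mul (cut_interval A1 k) (cut_interval A2 k).
  rewrite /cut_interval interval_mulE //; last by have := l2 k; have := r2 k; lra.
  by rewrite /A /= subKr subrKC.
have lpos k : 0 < lspread A k.
  rewrite /A /= subr_gt0 gt_min; apply/orP.
  have := neg k; have := r1 k; have := l2 k; have := r2 k.
  (* For a nonnegative mean of [A2] the first corner is negative; otherwise the second has factors
     of larger absolute value than the two means. *)
  by have [a0|a0] := leP 0 (mean A2) => *; [left|right]; nra.
have rpos k : 0 < rspread A k.
  rewrite /A /= subr_gt0 lt_max; apply/orP.
  have := neg k; have := r1 k; have := l2 k; have := r2 k.
  by have [a0|a0] := leP 0 (mean A2) => *; [left|right]; nra.
have mono k k' : lspread A1 k <= lspread A1 k' -> rspread A1 k <= rspread A1 k' ->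
    lspread A2 k <= lspread A2 k' -> rspread A2 k <= rspread A2 k' ->
    lspread A k <= lspread A k' /\ rspread A k <= rspread A k'.
  move=> hl1 hr1 hl2 hr2; rewrite /A /= lerD2l lerN2 lerD2r le_min ge_max.
  have := l1 k; have := r1 k; have := l2 k; have := r2 k => *.
  (* The corners at grade [k] are products of points of the cuts at [k'], so the bounds at [k']
     apply to them. *)
  have bnd x y := mul_interval_bounds _ _ (mean A2 - lspread A2 k')
    (mean A2 + rspread A2 k') x y (zero_in k').
  split; apply/andP; split.
  - by case/andP: (bnd (mean A1 - lspread A1 k) (mean A2 + rspread A2 k)
      ltac:(lra) ltac:(lra)).
  - by case/andP: (bnd (mean A1 + rspread A1 k) (mean A2 - lspread A2 k)
      ltac:(lra) ltac:(lra)).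
  - by case/andP: (bnd (mean A1 + rspread A1 k) (mean A2 + rspread A2 k)
      ltac:(lra) ltac:(lra)).
  - by case/andP: (bnd (mean A1 - lspread A1 k) (mean A2 - lspread A2 k)
      ltac:(lra) ltac:(lra)).
split.
  move=> B; split=> [[mB cB]|->]; last by split.
  have eqB k : lspread B k = lspread A k /\ rspread B k = rspread A k.
    have : cut_interval B k = cut_interval A k by rewrite cB cutA.
    (* Equal cuts have equal endpoints, and the means agree, so the spreads agree. *)
    move=> /itvcc_inj[|eqp eqq]; first by have := lpos k; have := rpos k; lra.
    by move: eqp eqq; rewrite mB /A /=; split; lra.
  case: B mB eqB {cB} => mB lB rB /= -> eqB; congr LRTuple;
    by apply/funext => k; case: (eqB k).
apply: lr_conditions_ivifn => //.
case: ol1 ol2 or1 or2 => ? ? ? ? [? ? ? ?] [? ? ? ?] [? ? ? ?].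
by split=> //; split; apply mono.
Qed.
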